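(* For $s>0$, define $\boldsymbol \mu(s)$ as the unique minimizer of the regularized and constrained minimization problem \[ \min_{\boldsymbol \theta \in \mathbb{R}^d,\ \boldsymbol \theta \geq \mathbf{0}} \left\{ f(\boldsymbol \theta) + \frac{1}{s} \langle \boldsymbol k, \boldsymbol \theta \rangle \right\} \] and let $I(s) = \{ i \in \{1, \dots, d\} \mid \mu_i(s) > 0 \}$. Then: (1) The minimizer $\boldsymbol \mu(s)$ is nondecreasing in $s$, i.e., for all $i \in \{1,\dots,d\}$, $\mu_i(s)$ is nondecreasing in $s$. Consequently, $I(s)$ is nondecreasing in $s$ for the inclusion. (2) Denote $s_1, \dots, s_q$ the points of discontinuity of the function $s \mapsto I(s)$. For all $s > 0$, $s \neq s_1, \dots, s_q$, \[ \boldsymbol \theta^{(\varepsilon)}\left(s \log \tfrac{1}{\varepsilon}\right) \xrightarrow[\varepsilon \to 0]{} \boldsymbol \theta_*^{(I(s))} . \] Moreover, the convergence is uniform for $s$ in compact subsets of $\mathbb{R}_{>0} \setminus \{s_1, \dots, s_q\}$. (3) For all $s>0$, \[ \frac{1}{s \log \frac{1}{\varepsilon}} \int_{0}^{s \log \frac{1}{\varepsilon}} \boldsymbol \theta^{(\varepsilon)}(t)\, \mathrm{d} t \xrightarrow[\varepsilon \to 0]{} \boldsymbol \mu(s) . \] Moreover, the convergence is uniform for $s$ in compact subsets of $\mathbb{R}_{>0}$.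
   Context: Let $\boldsymbol X \in \mathbb{R}^{n\times d}$ (rows $\boldsymbol x_1,\dots,\boldsymbol x_n$, columns/features $\boldsymbol X_1,\dots,\boldsymbol X_d$), $\boldsymbol y \in \mathbb{R}^n$, $\boldsymbol M = \boldsymbol X^\top \boldsymbol X$, $\boldsymbol r = \boldsymbol X^\top \boldsymbol y$, and $f(\boldsymbol \theta) = \frac{1}{2}\Vert \boldsymbol y\Vert^2 - \langle \boldsymbol r, \boldsymbol \theta\rangle + \frac12 \langle \boldsymbol \theta, \boldsymbol M \boldsymbol \theta\rangle$. Assume (A1) $\boldsymbol r > \mathbf{0}$ (all coordinates positive) and (A2) $M_{ij} = \langle \boldsymbol X_i, \boldsymbol X_j\rangle \leq 0$ for all $i \neq j$. The diagonal linear network dynamics (gradient flow in $u_i$ with $\theta_i = u_i^2/4$) is \[ \frac{\mathrm{d} \theta_i}{\mathrm{d} t} = \theta_i \Big( r_i - \sum_{j=1}^{d} M_{ij} \theta_j \Big), \quad i=1,\dots,d. \] For $\varepsilon>0$, $\boldsymbol \theta^{(\varepsilon)}(t)$ denotes the solution of this ODE started from $\boldsymbol \theta^{(\varepsilon)}(0) = (C_1 \varepsilon^{k_1}, \dots, C_d \varepsilon^{k_d})$ with constants $\boldsymbol C = (C_1,\dots,C_d) > \mathbf{0}$ and $\boldsymbol k = (k_1,\dots,k_d) > \mathbf{0}$. For $I \subset \{1,\dots,d\}$, $\boldsymbol \theta_*^{(I)}$ denotes the unique fixed point $\boldsymbol \theta \geq \mathbf{0}$ of this ODE with support $\{i : \theta_i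 > 0\}$ equal to $I$; explicitly $(\boldsymbol \theta_*^{(I)})_I = (\boldsymbol M_{II})^{-1}\boldsymbol r_I$ and $(\boldsymbol \theta_*^{(I)})_{I^c} = \mathbf{0}$, where $\boldsymbol M_{II}$ is the principal submatrix of $\boldsymbol M$ indexed by $I$ and $\boldsymbol r_I$ the subvector of $\boldsymbol r$ indexed by $I$. Vector inequalities are coordinatewise. *)

(* Defs.v *)
From HB Require Import structures.
From mathcomp Require Import all_boot all_order all_algebra.
From mathcomp Require Import all_classical all_reals all_analysis.
Set Implicit Arguments. Unset Strict Implicit. Unset Printing Implicit Defensive.
Import Order.TTheory GRing.Theory Num.Theory.
Import numFieldNormedType.Exports.
Local Open Scope classical_set_scope.
Local Open Scope ring_scope.

Section DLN.
Variables (R : realType) (n d : nat) (X : 'M[R]_(n, d)) (y : 'cV[R]_n).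

Definition Mmat : 'M[R]_d := X^T *m X.
Definition rvec (i : 'I_d) : R := (X^T *m y) i 0.

Definition fobj (th : 'I_d -> R) : R :=
  2^-1 * (\sum_(a < n) y a 0 ^+ 2) - \sum_i rvec i * th i
  + 2^-1 * (\sum_i \sum_j th i * Mmat i j * th j).

Definition Fobj (k : 'I_d -> R) (s : R) (th : 'I_d -> R) : R :=
  fobj th + s^-1 * (\sum_i k i * th i).

Definition is_minimizer (k : 'I_d -> R) (s : R) (th : 'I_d -> R) : Prop :=
  (forall i, 0 <= th i) /\
  (forall ph : 'I_d -> R, (forall i, 0 <= ph i) -> Fobj k s th <= Fobj k s ph).

(* theta_*^(I): (theta)_I = (M_II)^{-1} r_I, (theta)_{I^c} = 0.
   Indices of I are enumerated by enum_val : 'I_#|I| -> 'I_d. *)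
Definition MII (I : {set 'I_d}) : 'M[R]_#|I| :=
  \matrix_(a, b) Mmat (enum_val a) (enum_val b).
Definition rI (I : {set 'I_d}) : 'cV[R]_#|I| := \col_a rvec (enum_val a).
Definition theta_star (I : {set 'I_d}) (i : 'I_d) : R :=
  \sum_(a < #|I|) (if enum_val a == i then (invmx (MII I) *m rI I) a 0 else 0).

Definition is_DLN_solution (C k : 'I_d -> R) (theta : R -> R -> 'I_d -> R) : Prop :=
  forall eps : R, 0 < eps ->
    (forall i, theta eps 0 i = C i * eps `^ k i) /\
    (forall i, {within [set t : R | 0 <= t], continuous (fun t => theta eps t i)}) /\
    (forall i (t : R), 0 < t ->
       is_derive t 1 (fun u => theta eps u i)
         (theta eps t i * (rvec i - \sum_j Mmat i j * theta eps t j))).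

End DLN.

Definition supp {R : realType} {d : nat} (v : 'I_d -> R) : {set 'I_d} :=
  [set i | 0 < v i].

Definition Idisc {R : realType} {d : nat} (mu : R -> 'I_d -> R) (s : R) : Prop :=
  ~ (\forall u \near s, supp (mu u) = supp (mu s)).

(* Main.v *)
(* Since [r > 0] and [M] has nonpositive off-diagonal entries, the form
   [<theta, M theta>] is positive definite and the flow is cooperative: started
   near [0], every coordinate [theta_i] is positive, bounded and nondecreasing.
   Integrating [(ln theta_i)' = r_i - (M theta)_i] over [0, t] with
   [t = s ln (1/eps)], the time average [m] of the trajectory satisfies
   [(M m - r + k/s)_i = (ln C_i - ln (theta_i t)) / t].  As [m_i <= theta_i t],
   these are the optimality conditions of the minimizer [mu s] up to [O(1/t)],
   and strong convexity gives [|m - mu s|^2 = O(1/t)].  For the pointwise limit,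
   monotonicity squeezes [theta] between its averages over adjacent windows; on an
   interval where the support [I] of [mu] is constant, [s * mu s] is affine in [s]
   with slope [theta_star I]. *)
Require Import Defs.
From HB Require Import structures.
From mathcomp Require Import all_boot all_order all_algebra.
From mathcomp Require Import all_classical all_reals all_analysis.
From mathcomp Require Import ring lra.
Set Implicit Arguments.
Unset Strict Implicit.
Unset Printing Implicit Defensive.
Import Order.TTheory GRing.Theory Num.Theory.
Import numFieldNormedType.Exports.
Local Open Scope classical_set_scope.
Local Open Scope ring_scope.

(** * The quadratic form *)

Lemma unitmx_inj (F : fieldType) (m : nat) (A : 'M[F]_m) :
  (forall w : 'cV[F]_m, A *m w = 0 -> w = 0) -> A \in unitmx.
Proof.
move=> kerA0; rewrite -unitmx_tr -row_free_unit -kermx_eq0; apply/eqP.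
apply/row_matrixP => i; rewrite row0; apply: trmx_inj; rewrite trmx0.
apply: kerA0; apply: trmx_inj.
by rewrite trmx_mul trmxK -row_mul mulmx_ker row0 trmx0.
Qed.

Section QuadraticForm.
Context {R : realType} {n d : nat} (X : 'M[R]_(n, d)) (y : 'cV[R]_n).
Implicit Types v w : 'I_d -> R.

Definition mulM v i : R := \sum_j Mmat X i j * v j.
Definition dotM v w : R := \sum_i v i * mulM w i.
Definition mulX v (a : 'I_n) : R := \sum_i X a i * v i.

Lemma MmatE i j : Mmat X i j = \sum_a X a i * X a j.
Proof. by rewrite /Mmat mxE; apply: eq_bigr => a _; rewrite mxE. Qed.

(** The Gram structure [M = X^T X], the source of both symmetry and nonnegativity of the form. *)
Lemma dotM_mulX v w : dotM v w = \sum_a mulX v a * mulX w a.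
Proof.
transitivity (\sum_i \sum_j \sum_a (X a i * v i) * (X a j * w j)).
  apply: eq_bigr => i _; rewrite /mulM mulr_sumr; apply: eq_bigr => j _.
  rewrite MmatE mulr_suml mulr_sumr; apply: eq_bigr => a _; ring.
under eq_bigr do rewrite exchange_big /=.
rewrite exchange_big; apply: eq_bigr => a _; rewrite /mulX mulr_suml.
by apply: eq_bigr => i _; rewrite mulr_sumr.
Qed.

Lemma dotMC v w : dotM v w = dotM w v.
Proof. by rewrite !dotM_mulX; apply: eq_bigr => a _; rewrite mulrC. Qed.

Lemma dotM_ge0 v : 0 <= dotM v v.
Proof.
by rewrite dotM_mulX; apply: sumr_ge0 => a _; rewrite -expr2 sqr_ge0.
Qed.

Lemma mulMDZ v w (c : R) i :
  mulM (fun j => v j + c * w j) i = mulM v i + c * mulM w i.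
Proof.
rewrite /mulM mulr_sumr -big_split; apply: eq_bigr => j _ /=; ring.
Qed.

Lemma mulMB v w i : mulM (fun j => v j - w j) i = mulM v i - mulM w i.
Proof.
rewrite /mulM -sumrB; apply: eq_bigr => j _ /=; ring.
Qed.

Lemma dotMB v w :
  dotM (fun j => v j - w j) (fun j => v j - w j) =
  \sum_i (v i - w i) * (mulM v i - mulM w i).
Proof. by apply: eq_bigr => i _; rewrite mulMB. Qed.

Lemma dotMDZ v w (c : R) :
  dotM (fun j => v j + c * w j) (fun j => v j + c * w j) =
  dotM v v + 2 * c * dotM w v + c ^+ 2 * dotM w w.
Proof.
transitivity (dotM v v + c * dotM v w + c * dotM w v + c ^+ 2 * dotM w w).
  rewrite /dotM !mulr_sumr -!big_split; apply: eq_bigr => i _ /=.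
  rewrite mulMDZ; ring.
rewrite (dotMC v w); ring.
Qed.

Hypothesis r_gt0 : forall i, 0 < rvec X y i.
Hypothesis M_le0 : forall i j : 'I_d, i != j -> Mmat X i j <= 0.

(* Passing to [|v|] does not increase the form, since [M] has nonpositive
   off-diagonal entries; and [X |v| = 0] forces [<r, |v|> = <y, X |v|> = 0]. *)
Lemma dotM_eq0 v : dotM v v = 0 -> forall i, v i = 0.
Proof.
move=> v0; pose u i := `|v i|.
have u0 : dotM u u = 0.
  apply/eqP; rewrite eq_le dotM_ge0 andbT -v0.
  apply: ler_sum => i _; rewrite /mulM !mulr_sumr; apply: ler_sum => j _.
  rewrite !(mulrCA _ (Mmat X i j)) /u -normrM.
  have [->|neij] := eqVneq i j.
    by rewrite ger0_norm // -expr2 sqr_ge0.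
  by rewrite ler_wnM2l ?M_le0 // ler_norm.
have Xu0 a : mulX u a = 0.
  move: u0; rewrite dotM_mulX => /psumr_eq0P u0.
  have /eqP : mulX u a * mulX u a = 0.
    by apply: u0 => // b _; rewrite -expr2 sqr_ge0.
  by rewrite mulf_eq0 orbb => /eqP.
have : \sum_i rvec X y i * u i = 0.
  transitivity (\sum_a y a 0 * mulX u a); last first.
    by rewrite big1 // => a _; rewrite Xu0 mulr0.
  under [RHS]eq_bigr do rewrite mulr_sumr.
  rewrite exchange_big; apply: eq_bigr => i _ /=.
  rewrite /rvec mxE mulr_suml; apply: eq_bigr => a _; rewrite mxE; ring.
move=> /psumr_eq0P ru0 i.
have /eqP : rvec X y i * u i = 0.
  by apply: ru0 => // j _; rewrite mulr_ge0 ?normr_ge0 ?(ltW (r_gt0 j)).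
by rewrite mulf_eq0 gt_eqF //= normr_eq0 => /eqP.
Qed.

Lemma Mmat_unit : Mmat X \in unitmx.
Proof.
apply: unitmx_inj => w Mw0; apply/colP => i; rewrite mxE.
apply: (@dotM_eq0 (fun j => w j 0)); rewrite /dotM big1 // => j _.
have /colP/(_ j) := Mw0; rewrite !mxE /mulM => ->; exact: mulr0.
Qed.

(** [P = M^-1 X^T] is a left inverse of [X], so [v = P (X v)], and each coordinate of [X v] is at
    most [sqrt (dotM v v)] in absolute value. The summand 1 in [c] keeps it positive even for
    [d = 0]. *)
Lemma dotM_coercive :
  exists2 c : R, 0 < c & forall v i, `|v i| <= c * Num.sqrt (dotM v v).
Proof.
have [P PX] : exists P : 'M[R]_(d, n), P *m X = 1%:M.
  by exists (invmx (Mmat X) *m X^T); rewrite -mulmxA mulVmx // Mmat_unit.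
pose c := 1 + \sum_i \sum_a `|P i a|.
have S0 i : 0 <= \sum_a `|P i a| by apply: sumr_ge0.
have c0 : 0 < c by rewrite ltr_pwDl // sumr_ge0.
exists c => // v i; set q := Num.sqrt _.
have vE : v i = \sum_a P i a * mulX v a.
  have /colP/(_ i) : P *m (X *m (\col_j v j)) = \col_j v j.
    by rewrite mulmxA PX mul1mx.
  rewrite !mxE => <-; apply: eq_bigr => a _; rewrite mxE.
  by congr (_ * _); apply: eq_bigr => j _; rewrite mxE.
have Xq a : `|mulX v a| <= q.
  rewrite -sqrtr_sqr /q dotM_mulX ler_wsqrtr // (bigD1 a) //= -expr2.
  by rewrite lerDl sumr_ge0 // => b _; rewrite -expr2 sqr_ge0.
rewrite vE; apply: (le_trans (ler_norm_sum _ _ _)).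
apply: (@le_trans _ _ (\sum_a `|P i a| * q)).
  by apply: ler_sum => a _; rewrite normrM ler_wpM2l.
rewrite -mulr_suml ler_wpM2r ?sqrtr_ge0 //.
by rewrite /c (bigD1 i) //= addrCA lerDl addr_ge0 // sumr_ge0.
Qed.

(** With [q = sqrt (dotM v v)], coercivity turns the premise into [q^2 <= c S q], hence [q <= c S];
    coercivity again bounds the coordinates. The same [B] serves trajectories and minimizers. *)
Lemma subsolution_bounded :
  exists2 B : R, 0 < B & forall v,
    dotM v v <= \sum_i rvec X y i * v i -> forall i, v i <= B.
Proof.
have [c c0 cP] := dotM_coercive.
pose S := \sum_i rvec X y i.
have S0 : 0 <= S by apply: sumr_ge0 => i _; apply: ltW.
exists (1 + c * (c * S)); first by rewrite ltr_pwDl // !mulr_ge0 // ltW.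
move=> v vr i; pose q := Num.sqrt (dotM v v).
have qq : q ^+ 2 <= c * S * q.
  rewrite sqr_sqrtr ?dotM_ge0 //; apply: le_trans vr _.
  rewrite /S mulrAC mulrC mulr_suml; apply: ler_sum => j _.
  by rewrite ler_wpM2l ?(ltW (r_gt0 j)) // (le_trans (ler_norm _)).
have q0 : 0 <= q by apply: sqrtr_ge0.
have qS : q <= c * S.
  move: q0; rewrite le_eqVlt => /orP[/eqP <-|q0].
    by rewrite mulr_ge0 // ltW.
  by move: qq; rewrite expr2 ler_pM2r.
apply: (le_trans (ler_norm _)); apply: (le_trans (cP v i)).
apply: (@le_trans _ _ (c * (c * S))); first by rewrite ler_pM2l.
by rewrite lerDr.
Qed.

Lemma MII_mulE (I : {set 'I_d}) (w : 'cV[R]_#|I|) i (iI : i \in I) :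
  (MII X I *m w) (enum_rank_in iI i) 0 =
  \sum_(b < #|I|) Mmat X i (enum_val b) * w b 0.
Proof.
rewrite mxE; apply: eq_bigr => b _; congr (_ * _).
by rewrite mxE enum_rankK_in.
Qed.

(** A kernel vector extended by zero outside [I] satisfies [v_i (M v)_i = 0] for every [i], so
    definiteness of the full form makes it vanish. *)
Lemma MII_unit (I : {set 'I_d}) : MII X I \in unitmx.
Proof.
apply: unitmx_inj => w Mw0; apply/colP => a; rewrite mxE.
pose v i := \sum_(b < #|I| | enum_val b == i) w b 0.
have vval b : v (enum_val b) = w b 0.
  rewrite /v (big_pred1 b) // => b'; exact: (inj_eq enum_val_inj).
have vout i : i \notin I -> v i = 0.
  move=> iI; rewrite /v big_pred0 // => b; apply: contraNF iI => /eqP <-.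
  exact: enum_valP.
rewrite -vval; apply: dotM_eq0; rewrite /dotM big1 // => i _.
have [iI|/vout ->] := boolP (i \in I); last by rewrite mul0r.
suff -> : mulM v i = 0 by rewrite mulr0.
have /colP/(_ (enum_rank_in iI i)) := Mw0.
rewrite MII_mulE [RHS]mxE => <-.
rewrite /mulM (bigID (mem I)) /= [X in _ + X]big1 ?addr0; last first.
  by move=> j /vout ->; rewrite mulr0.
rewrite big_enum_val; apply: eq_bigr => b _.
by rewrite vval.
Qed.

Lemma theta_star_out (I : {set 'I_d}) i : i \notin I -> theta_star X y I i = 0.
Proof.
move=> iI; rewrite /theta_star big1 // => a _; case: eqP => // ai.
by move: iI; rewrite -ai enum_valP.
Qed.

Lemma mulM_theta_star (I : {set 'I_d}) i :
  i \in I -> mulM (theta_star X y I) i = rvec X y i.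
Proof.
move=> iI; pose w := invmx (MII X I) *m rI X y I.
have /colP/(_ (enum_rank_in iI i)) : MII X I *m w = rI X y I.
  by rewrite mulmxA mulmxV ?mul1mx ?MII_unit.
rewrite MII_mulE [RHS]mxE enum_rankK_in // => <-.
rewrite /mulM (bigID (mem I)) /= [X in _ + X]big1 ?addr0; last first.
  by move=> j /theta_star_out ->; rewrite mulr0.
rewrite big_enum_val; apply: eq_bigr => b _.
congr (_ * _); rewrite /theta_star (bigD1 b) //= eqxx big1 ?addr0 // => a neab.
by rewrite (inj_eq enum_val_inj) (negbTE neab).
Qed.

(** For the difference [z] of the two vectors, each product [z_i (M z)_i] has a zero factor, so
    [<z, M z> = 0]. *)
Lemma theta_star_unique (I : {set 'I_d}) v :
  (forall i, i \notin I -> v i = 0) ->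
  (forall i, i \in I -> mulM v i = rvec X y i) ->
  forall i, v i = theta_star X y I i.
Proof.
move=> vout vin i; apply/eqP; rewrite -subr_eq0; apply/eqP.
apply: (@dotM_eq0 (fun j => v j - theta_star X y I j)).
rewrite dotMB big1 // => j _; have [jI|jI] := boolP (j \in I).
  by rewrite vin // mulM_theta_star // subrr mulr0.
by rewrite vout // theta_star_out // subrr mul0r.
Qed.

End QuadraticForm.

(** * The regularized minimizer *)

Section Minimizer.
Context {R : realType} {n d : nat} (X : 'M[R]_(n, d)) (y : 'cV[R]_n).
Implicit Types v w k mu : 'I_d -> R.

Definition gradF k s v i : R := mulM X v i - rvec X y i + s^-1 * k i.

(** The objective is quadratic, so its second-order expansion is exact. *)
Lemma FobjDZ k s v w (c : R) :
  Fobj X y k s (fun j => v j + c * w j) =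
  Fobj X y k s v + c * \sum_i gradF k s v i * w i
    + 2^-1 * c ^+ 2 * dotM X w w.
Proof.
have dotE u : \sum_i \sum_j u i * Mmat X i j * u j = dotM X u u.
  apply: eq_bigr => i _; rewrite /mulM mulr_sumr.
  by apply: eq_bigr => j _; rewrite mulrA.
have linE (l : 'I_d -> R) :
    \sum_i l i * (v i + c * w i) = \sum_i l i * v i + c * \sum_i l i * w i.
  rewrite mulr_sumr -big_split; apply: eq_bigr => i _ /=; ring.
have -> : \sum_i gradF k s v i * w i =
    dotM X w v - \sum_i rvec X y i * w i + s^-1 * \sum_i k i * w i.
  rewrite mulr_sumr -sumrB -big_split; apply: eq_bigr => i _ /=.
  rewrite /gradF; ring.
rewrite /Fobj /fobj !dotE dotMDZ !linE; move: s^-1 => t; by field.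
Qed.

(** First-order optimality on a convex set: with a negative slope [L] towards [ph], a partial move
    along the segment would lower the objective. *)
Lemma minimizer_variational k s mu ph :
  is_minimizer X y k s mu -> (forall i, 0 <= ph i) ->
  0 <= \sum_i gradF k s mu i * (ph i - mu i).
Proof.
move=> [mu0 mumin] ph0; rewrite leNgt; apply/negP.
set L := \sum_i _ => L0.
pose w i := ph i - mu i; pose q := dotM X w w.
have q0 : 0 <= q by apply: dotM_ge0.
(* This step lies in [(0, 1]], also when [q = 0], and satisfies [c q = c L - L], so that
   [L + c q / 2 = L (1 + c) / 2] is negative. *)
pose c := - L / (q - L).
have qL0 : 0 < q - L by lra.
have c0 : 0 < c by rewrite divr_gt0 // oppr_gt0.
have cE : c * (q - L) = - L by rewrite divfK // gt_eqF.
have c1 : c <= 1 by rewrite ler_pdivrMr // mul1r; lra.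
have : Fobj X y k s mu <= Fobj X y k s (fun j => mu j + c * w j).
  apply: mumin => i; have -> : mu i + c * w i = (1 - c) * mu i + c * ph i.
    by rewrite /w; ring.
  by rewrite addr_ge0 // mulr_ge0 // ?subr_ge0 // ltW.
rewrite FobjDZ -/L -/q => F0.
have : 0 <= c * (L + 2^-1 * (c * q)) by lra.
rewrite pmulr_rge0 // => {}F0.
have : c * L <= 0 by rewrite pmulr_rle0 // ltW.
lra.
Qed.

Lemma minimizer_grad_ge0 k s mu i :
  is_minimizer X y k s mu -> 0 <= gradF k s mu i.
Proof.
move=> mumin; have := @minimizer_variational k s mu
  (fun j => mu j + (i == j)%:R) mumin.
rewrite (bigD1 i) //= eqxx big1 => [|j /negbTE neji].
  rewrite addr0 addrC addKr mulr1; apply => j.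
  by rewrite addr_ge0 // mumin.1.
by rewrite eq_sym neji addr0 subrr mulr0.
Qed.

(** Complementary slackness: the products are nonnegative, and comparison with the zero vector makes
    their sum at most 0. *)
Lemma minimizer_grad_mul k s mu : is_minimizer X y k s mu ->
  forall i, gradF k s mu i * mu i = 0.
Proof.
move=> mumin; have gmu0 i : 0 <= gradF k s mu i * mu i.
  by rewrite mulr_ge0 ?minimizer_grad_ge0 ?mumin.1.
have /psumr_eq0P S0 : forall i : 'I_d, true -> 0 <= gradF k s mu i * mu i by [].
move=> i; apply: S0 => //; apply/eqP; rewrite eq_le sumr_ge0 // andbT.
have := @minimizer_variational k s mu (fun=> 0) mumin (fun=> lexx _).
by under eq_bigr do rewrite sub0r mulrN; rewrite sumrN oppr_ge0.
Qed.

(** Slackness gives [mu_i (M mu)_i = r_i mu_i - k_i mu_i / s]; dropping the penalty brings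
    minimizers under [subsolution_bounded]. *)
Lemma minimizer_subsolution k s mu : 0 < s -> (forall i, 0 < k i) ->
  is_minimizer X y k s mu -> dotM X mu mu <= \sum_i rvec X y i * mu i.
Proof.
move=> s0 k0 mumin; apply: ler_sum => i _.
have := minimizer_grad_mul mumin i; rewrite /gradF => g0.
have : 0 <= s^-1 * k i * mu i.
  by rewrite !mulr_ge0 ?mumin.1 ?invr_ge0 // ltW.
lra.
Qed.

Hypothesis r_gt0 : forall i, 0 < rvec X y i.
Hypothesis M_le0 : forall i j : 'I_d, i != j -> Mmat X i j <= 0.

(** Testing each minimizer against the other, the two variational inequalities add up to
    [<mu - nu, M (mu - nu)> <= 0]. *)
Lemma minimizer_unique k s mu nu :
  is_minimizer X y k s mu -> is_minimizer X y k s nu -> mu = nu.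
Proof.
move=> mumin numin; apply/funext => i; apply/eqP; rewrite -subr_eq0; apply/eqP.
apply: (dotM_eq0 r_gt0 M_le0 (v := fun j => mu j - nu j)).
apply/eqP; rewrite eq_le dotM_ge0 andbT dotMB.
have := minimizer_variational mumin numin.1.
have := minimizer_variational numin mumin.1.
rewrite -oppr_le0 -(oppr_le0 (\sum_i gradF k s mu i * _)) -!sumrN => le1 le2.
have := lerD le1 le2; rewrite addr0 -big_split /=.
congr (_ <= _); apply: eq_bigr => j _; rewrite /gradF; ring.
Qed.

(* With [w] the positive part of [mu1 - mu2], comparing with [mu1 - w] and
   [mu2 + w] gives [<w, M (mu1 - mu2)> <= 0], and [<w, M w> <= <w, M (mu1 - mu2)>]
   because the off-diagonal entries of [M] are nonpositive. *)
Lemma minimizer_monotone k s1 s2 mu1 mu2 : (forall i, 0 < k i) ->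
  0 < s1 -> s1 <= s2 ->
  is_minimizer X y k s1 mu1 -> is_minimizer X y k s2 mu2 ->
  forall i, mu1 i <= mu2 i.
Proof.
move=> k0 s10 s12 min1 min2.
pose w i := Num.max 0 (mu1 i - mu2 i).
have w0 i : 0 <= w i by rewrite le_max lexx.
have wge i : mu1 i - mu2 i <= w i by rewrite le_max lexx orbT.
have wcase i : w i = 0 \/ w i = mu1 i - mu2 i.
  by rewrite /w /Num.max; case: ifP => _; [right | left].
have VI1 : 0 <= \sum_i gradF k s1 mu1 i * ((mu1 i - w i) - mu1 i).
  apply: minimizer_variational => // i.
  have := min1.1 i; have := min2.1 i; case: (wcase i) => ->; lra.
have VI2 : 0 <= \sum_i gradF k s2 mu2 i * ((mu2 i + w i) - mu2 i).
  apply: minimizer_variational => // i.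
  by rewrite addr_ge0 // min2.1.
have wMle : \sum_i w i * (mulM X mu1 i - mulM X mu2 i) <= 0.
  rewrite -(oppr_ge0 (\sum_i _)); apply: (le_trans (addr_ge0 VI1 VI2)).
  rewrite -big_split /= -sumrN; apply: ler_sum => i _.
  have : 0 <= (s1^-1 - s2^-1) * k i * w i.
    rewrite !mulr_ge0 ?(ltW (k0 i)) // subr_ge0 lef_pV2 // posrE //.
    exact: lt_le_trans s12.
  rewrite /gradF; lra.
have w00 i : w i = 0.
  apply: (dotM_eq0 r_gt0 M_le0); apply/eqP; rewrite eq_le dotM_ge0 andbT.
  apply: le_trans wMle; apply: ler_sum => {}i _; rewrite -mulMB.
  rewrite /mulM !mulr_sumr; apply: ler_sum => j _.
  rewrite !(mulrCA (w i)) ; have [<-|neij] := eqVneq i j.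
    by case: (wcase i) => ->; rewrite ?mul0r ?mulr0.
  by rewrite ler_wnM2l ?M_le0 // ler_wpM2l.
by move=> i; have := wge i; rewrite w00 subr_le0.
Qed.

End Minimizer.

(** * Calculus *)

Section Calculus.
Context {R : realType}.
Implicit Types f g df : R -> R.

Lemma ge0_derive_le f df a b : a <= b ->
  (forall t, a <= t <= b -> {for t, continuous f}) ->
  (forall t, a < t < b -> is_derive t 1 f (df t)) ->
  (forall t, a < t < b -> 0 <= df t) -> f a <= f b.
Proof.
rewrite le_eqVlt => /predU1P[-> //|ab] cf dfP df0.
have dfab x : x \in `]a, b[%R -> is_derive x 1 f (df x).
  by rewrite in_itv; exact: dfP.
have cfab : {within `[a, b], continuous f}.
  by apply: continuous_in_subspaceT => x /set_mem; rewrite /= in_itv; exact: cf.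
have [c cab E] := MVT ab dfab cfab.
rewrite -subr_ge0 E mulr_ge0 ?subr_ge0 ?(ltW ab) // df0 //.
Qed.

Lemma derive0_eq f a b : a <= b ->
  (forall t, a <= t <= b -> {for t, continuous f}) ->
  (forall t, a < t < b -> is_derive t 1 f 0) -> f a = f b.
Proof.
move=> ab cf df0; apply/eqP; rewrite eq_le.
rewrite (@ge0_derive_le f (fun=> 0)) //= -lerN2.
apply: (@ge0_derive_le (fun t => - f t) (fun=> 0)) => // t tab.
  by apply: continuousN; exact: cf.
by apply: is_derive_eq; [apply: is_deriveN; exact: df0 | rewrite oppr0].
Qed.

(** The even extension puts a trajectory, continuous only on the half-line, within reach of
    [primitive_exists]. *)
Lemma continuous_comp_norm f :
  {within [set t : R | 0 <= t], continuous f} -> continuous (fun t : R => f `|t|).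
Proof.
move=> /subspace_continuousP cf x.
apply: (@cvg_comp _ _ _ (fun t : R => `|t| : R) f (nbhs x)
    (within [set t : R | 0 <= t] (nbhs (`|x| : R)))).
  move=> A nA.
  have : \forall t \near x, [set u : R | 0 <= u -> A u] `|t|.
    exact: (@norm_continuous R R x _ nA).
  by apply: filterS => t; apply; exact: normr_ge0.
exact: (cf `|x| (normr_ge0 x)).
Qed.

Lemma is_derive_continuous f (t df : R) :
  is_derive t 1 f df -> {for t, continuous f}.
Proof.
by move=> [dft _]; apply: differentiable_continuous; apply/derivable1_diffP.
Qed.

Lemma primitive_exists g : continuous g ->
  exists G : R -> R, [/\ G 0 = 0,
    forall t : R, -1 < t -> is_derive t 1 G (g t) &
    forall t : R, 0 <= t -> G t = \int[lebesgue_measure]_(u in `[0, t]) g u].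
Proof.
move=> cg.
have intg a b : lebesgue_measure.-integrable `[a, b] (EFin \o g).
  apply: continuous_compact_integrable; first exact: segment_compact.
  exact: continuous_subspaceT.
(* Starting the integral at [-1] makes the primitive differentiable at [0]. *)
pose H (t : R) := \int[lebesgue_measure]_(u in `[-1, t]) g u.
exists (fun t => H t - H 0); split; first exact: subrr.
- move=> t t1.
  have [|dH H'] := @continuous_FTC1_closed R g (-1) t (t + 1) _ (intg _ _) t1 (cg t).
    by rewrite ltrDl.
  have dHt : is_derive t 1 H (g t) by split => //; rewrite -H' derive1E.
  by apply: is_derive_eq; rewrite subr0.
- move=> t t0; rewrite /H Rintegral_itvB ?bnd_simp ?lerN10 //.
  rewrite Rintegral_itv_obnd_cbnd //.
  by apply: integrableS (intg 0 t) => //; exact: subset_itv_oc_cc.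
Qed.

Lemma is_derive_mul f g (t df dg : R) :
  is_derive t 1 f df -> is_derive t 1 g dg ->
  is_derive t 1 (fun u => f u * g u) (df * g t + f t * dg).
Proof.
move=> hf hg; apply: (@is_derive_eq _ _ _ _ _ _ _ _ (is_deriveM hf hg)).
by rewrite addrC; congr (_ + _); exact: mulrC.
Qed.

Lemma is_derive_expR_comp f (t df : R) :
  is_derive t 1 f df ->
  is_derive t 1 (fun u => expR (f u)) (df * expR (f t)).
Proof.
move=> hf.
apply: (@is_derive_eq _ _ _ _ _ _ _ _ (is_derive1_comp (is_derive_expR _) hf)).
by rewrite mulrC.
Qed.

Lemma is_derive_mulM n d (X : 'M[R]_(n, d)) (F : 'I_d -> R -> R)
    (dF : 'I_d -> R) (t : R) i : (forall j, is_derive t 1 (F j) (dF j)) ->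
  is_derive t 1 (fun u => mulM X (fun j => F j u) i) (mulM X dF i).
Proof.
move=> hF.
have -> : (fun u => mulM X (fun j => F j u) i) =
    \sum_(j < d) (Mmat X i j \*: F j) by apply/funext => u; rewrite fct_sumE.
apply: (@is_derive_sum _ _ _ d (fun j => Mmat X i j \*: F j)).
Qed.

Lemma cvg_mulM n d (X : 'M[R]_(n, d)) (F : set_system R) (f : 'I_d -> R -> R)
    (l : 'I_d -> R) i : Filter F -> (forall j, f j u @[u --> F] --> l j) ->
  mulM X (fun j => f j u) i @[u --> F] --> mulM X l i.
Proof.
move=> FF fl; apply: cvg_big; first exact: add_continuous.
by move=> j _; apply: cvgMl_tmp; exact: fl.
Qed.

End Calculus.

(** * Cooperative Lotka-Volterra trajectories *)

Section LotkaVolterra.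
Context {R : realType} {n d : nat} (X : 'M[R]_(n, d)) (r : 'I_d -> R).
Context (g G : 'I_d -> R -> R).
Hypothesis M_le0 : forall i j : 'I_d, i != j -> Mmat X i j <= 0.
Hypothesis g_cont : forall i, continuous (g i).
Hypothesis g_derive : forall i (t : R), 0 < t ->
  is_derive t 1 (g i) (g i t * (r i - mulM X (g ^~ t) i)).
Hypothesis G0 : forall i, G i 0 = 0.
Hypothesis G_derive : forall i (t : R), -1 < t -> is_derive t 1 (G i) (g i t).
Hypothesis g0_gt0 : forall i, 0 < g i 0.
Hypothesis g0_sub : forall i, mulM X (g ^~ 0) i < r i.

Let G_cont i (t : R) : 0 <= t -> {for t, continuous (G i)}.
Proof.
move=> t0; apply: is_derive_continuous; apply: G_derive.
exact: lt_le_trans t0.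
Qed.

(** With the integrating exponent [E = (M G)_i - r_i t], the product [g_i expR(E)] has zero
    derivative. Positivity of [g] then follows without taking its logarithm. *)
Lemma LV_expE i (t : R) : 0 <= t ->
  g i t = g i 0 * expR (r i * t - mulM X (G ^~ t) i).
Proof.
move=> t0.
pose E u := mulM X (G ^~ u) i - r i * u.
have E0 : E 0 = 0.
  by rewrite /E /mulM mulr0 subr0 big1 // => j _; rewrite G0 mulr0.
have dE (u : R) : 0 < u -> is_derive u 1 E (mulM X (g ^~ u) i - r i).
  move=> u0; apply: is_deriveB; last first.
    apply: (@is_derive_eq _ _ _ _ _ _ _ _ (is_deriveZ (r i) (is_derive_id u 1))).
    exact: mulr1.
  by apply: is_derive_mulM => j; apply: G_derive; exact: lt_trans u0.
suff : g i 0 * expR (E 0) = g i t * expR (E t).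
  rewrite E0 expR0 mulr1 => ->; rewrite -mulrA -expRD.
  have -> : E t + (r i * t - mulM X (G ^~ t) i) = 0 by rewrite /E; ring.
  by rewrite expR0 mulr1.
apply: (@derive0_eq R (fun u => g i u * expR (E u))) => //.
  move=> u /andP[u0 _]; apply: continuousM; first exact: g_cont.
  apply: continuous_comp; last exact: continuous_expR.
  apply: continuousB; last by apply: continuousM; [exact: cvg_cst | exact: cvg_id].
  by apply: cvg_mulM => j; exact: G_cont.
move=> u /andP[u0 _]; apply: is_derive_eq.
  by apply: is_derive_mul; [exact: g_derive | apply: is_derive_expR_comp; exact: dE].
rewrite /=; ring.
Qed.

Lemma LV_gt0 i (t : R) : 0 <= t -> 0 < g i t.
Proof. by move=> t0; rewrite LV_expE // mulr_gt0 // expR_gt0. Qed.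

Let a i t := r i - mulM X (g ^~ t) i.

Let a_cont i : continuous (a i).
Proof.
move=> t; apply: continuousB; first exact: cvg_cst.
by apply: cvg_mulM => j; exact: g_cont.
Qed.

(* The growth rates [a i] solve the cooperative linear system
   [a_i' = - \sum_j M_ij g_j a_j]; the integrating factor [expR (M_ii G_i)]
   removes the only term that may be negative. *)
Let a_gt0_step i (T : R) : 0 <= T -> (forall j (t : R), 0 <= t < T -> 0 < a j t) ->
  0 < a i T.
Proof.
move=> T0 aT; pose b t := a i t * expR (Mmat X i i * G i t).
suff : b 0 <= b T.
  rewrite /b G0 mulr0 expR0 mulr1 => le_b.
  have := lt_le_trans (_ : 0 < a i 0) le_b; rewrite subr_gt0 g0_sub => /(_ isT).
  by rewrite pmulr_lgt0 // expR_gt0.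
pose e t := expR (Mmat X i i * G i t).
apply: (@ge0_derive_le R b (fun t =>
  (\sum_(j | j != i) - Mmat X i j * (g j t * a j t)) * e t)) => //.
- move=> t /andP[t0 _]; apply: continuousM; first exact: a_cont.
  apply: continuous_comp; last exact: continuous_expR.
  by apply: continuousM; [exact: cvg_cst | exact: G_cont].
- move=> t /andP[t0 _].
  have da : is_derive t 1 (a i) (0 - mulM X (fun j => g j t * a j t) i).
    have dM := is_derive_mulM X i (fun j => g_derive j t0).
    exact: (is_deriveB (is_derive_cst (r i) t 1) dM).
  have dMG : is_derive t 1 (fun u => Mmat X i i * G i u) (Mmat X i i * g i t).
    apply: (is_deriveZ (f := G i) (Mmat X i i)).
    by apply: G_derive; exact: lt_trans t0.
  apply: (is_derive_eq (is_derive_mul da (is_derive_expR_comp dMG))).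
  have -> : \sum_(j | j != i) - Mmat X i j * (g j t * a j t) =
      Mmat X i i * (g i t * a i t) - mulM X (fun j => g j t * a j t) i.
    rewrite /mulM [in RHS](bigD1 i) //= opprD addNKr -sumrN.
    by apply: eq_bigr => j _; rewrite mulNr.
  rewrite /e /=; ring.
- move=> t /andP[t0 tT]; rewrite mulr_ge0 ?expR_ge0 // sumr_ge0 // => j ji.
  rewrite mulr_ge0 //.
    by rewrite oppr_ge0 M_le0 // eq_sym.
  by rewrite mulr_ge0 // ltW ?LV_gt0 ?aT ?(ltW t0) // tT.
Qed.

(** Continuation argument: at the infimum [T] of the times where some rate fails to be positive,
    [a_gt0_step] makes all rates positive, and continuity carries this past [T]. *)
Lemma LV_rate_gt0 i (t : R) : 0 <= t -> mulM X (g ^~ t) i < r i.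
Proof.
move=> t0; rewrite -subr_gt0 -/(a i t).
pose Z := [set u : R | 0 <= u /\ exists j, a j u <= 0].
have [noZ|Zex] := pselect (Z !=set0); last first.
  by rewrite ltNge; apply/negP => ai; apply: Zex; exists t; split => //; exists i.
exfalso.
have Zlb : lbound Z 0 by move=> u [].
set T := inf Z.
have T0 : 0 <= T by exact: lb_le_inf noZ Zlb.
have below j (u : R) : 0 <= u < T -> 0 < a j u.
  move=> /andP[u0 uT]; rewrite ltNge; apply/negP => aju.
  have : T <= u by apply: ge_inf; [exists 0 | split => //; exists j].
  by rewrite leNgt uT.
have aT j : 0 < a j T by apply: a_gt0_step.
have : \forall u \near T, forall j, 0 < a j u.
  apply: (@filter_forall R 'I_d (fun j u => 0 < a j u) (nbhs T)) => j.
  exact: (cvgr_gt _ (@a_cont j T) _ (aT j)).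
move=> [e /= e0 He].
have : T + e <= T.
  apply: (lb_le_inf noZ) => u [u0 [j aju]]; rewrite leNgt; apply/negP => ue.
  have [uT|Tu] := ltP u T.
    by have := below j u; rewrite u0 uT ltNge aju => /(_ isT).
  have := He u; rewrite /ball_ /= ler0_norm ?subr_le0 // opprB ltrBlDl => /(_ ue).
  by move=> /(_ j); rewrite ltNge aju.
by rewrite gerDl leNgt e0.
Qed.

Lemma LV_nondecreasing i (t u : R) : 0 <= t -> t <= u -> g i t <= g i u.
Proof.
move=> t0 tu; apply: (@ge0_derive_le R (g i)
  (fun v => g i v * (r i - mulM X (g ^~ v) i)) t u) => //.
- by move=> v _; exact: g_cont.
- by move=> v /andP[tv _]; apply: g_derive; exact: le_lt_trans tv.
- move=> v /andP[tv _]; have v0 : 0 <= v by rewrite (le_trans t0) // ltW.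
  by rewrite mulr_ge0 ?subr_ge0 // ltW ?LV_gt0 ?LV_rate_gt0.
Qed.

(** The increment of [G i] is [(u - t) * g i c] for some [c] between [t] and [u], and [g i] is
    nondecreasing. *)
Lemma LV_integral_bounds i (t u : R) : 0 <= t -> t <= u ->
  (u - t) * g i t <= G i u - G i t <= (u - t) * g i u.
Proof.
move=> t0; rewrite le_eqVlt => /predU1P[<-|tu].
  by rewrite !subrr !mul0r lexx.
have GE v : t <= v -> is_derive v 1 (G i) (g i v).
  by move=> tv; apply: G_derive; apply: lt_le_trans (le_trans t0 tv); lra.
have [||c + ->] := @MVT R (G i) (g i) t u tu.
  by move=> v; rewrite in_itv => /andP[/ltW tv _]; exact: GE.
  apply: continuous_in_subspaceT => v /set_mem; rewrite /= in_itv /= => /andP[tv _].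
  exact: is_derive_continuous (GE v tv).
rewrite in_itv => /andP[tc cu].
rewrite ![_ * (u - t)]mulrC !ler_pM2l ?subr_gt0 //.
rewrite !LV_nondecreasing ?(ltW tc) ?(ltW cu) //; exact: le_trans (ltW tc).
Qed.

End LotkaVolterra.

(** * Time averages *)

Section Averages.
Context {R : realType} {n d : nat} (X : 'M[R]_(n, d)) (y : 'cV[R]_n).
Implicit Types k C : 'I_d -> R.
Hypothesis r_gt0 : forall i, 0 < rvec X y i.
Hypothesis M_le0 : forall i j : 'I_d, i != j -> Mmat X i j <= 0.

(* The identity [ln (g_i t) = ln (g_i 0) + t (r_i - (M m)_i)] for the time
   average [m] shows that [m] satisfies the optimality conditions of the
   regularized problem up to an error [O(1/t)]; complementary slackness uses
   [m_i <= g_i t], that is, the monotonicity of the trajectory. *)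
Lemma average_near_minimizer k (lnC : 'I_d -> R) (g G : 'I_d -> R -> R)
    (L s B K : R) (mu : 'I_d -> R) :
  (forall i, 0 < k i) -> 0 < L -> 0 < s ->
  (forall i (t : R), 0 <= t -> 0 < g i t) ->
  (forall i (t : R), 0 <= t -> mulM X (g ^~ t) i <= rvec X y i) ->
  (forall i (t : R), 0 <= t ->
    ln (g i t) = lnC i - k i * L + rvec X y i * t - mulM X (G ^~ t) i) ->
  (forall i (t : R), 0 < t -> 0 < G i t <= t * g i t) ->
  0 <= B ->
  (forall v, dotM X v v <= \sum_i rvec X y i * v i -> forall i, v i <= B) ->
  (forall i, `|lnC i| <= K) -> 0 <= K ->
  is_minimizer X y k s mu ->
  dotM X (fun i => (s * L)^-1 * G i (s * L) - mu i)
         (fun i => (s * L)^-1 * G i (s * L) - mu i) <=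
    (d%:R * (B * K + 1 + B * (B + K))) / (s * L).
Proof.
move=> k0 L0 s0 gpos gsub glog Gb B0 subB CK K0 mumin.
set t := s * L; have t0 : 0 < t by rewrite mulr_gt0.
pose m i := t^-1 * G i t.
change (dotM X (fun i => m i - mu i) (fun i => m i - mu i) <=
  d%:R * (B * K + 1 + B * (B + K)) / t).
have gB i : g i t <= B.
  apply: (subB (g ^~ t)); apply: ler_sum => j _.
  by rewrite mulrC ler_wpM2r ?gsub // ltW ?gpos // ltW.
have muB i : mu i <= B by apply: subB; exact: minimizer_subsolution mumin.
have mpos i : 0 < m i.
  by rewrite mulr_gt0 ?invr_gt0 //; have /andP[] := Gb i t t0.
have mg i : m i <= g i t.
  by rewrite ler_pdivrMl //; have /andP[] := Gb i t t0.
have GE : (G ^~ t) = (fun i => 0 + t * m i).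
  by apply/funext => i; rewrite add0r /m mulVKf // gt_eqF.
have gradE i : t * gradF X y k s m i = lnC i - ln (g i t).
  rewrite glog ?(ltW t0) // GE mulMDZ /gradF.
  have -> : mulM X (fun=> 0) i = 0 by rewrite /mulM big1 // => j _; rewrite mulr0.
  have -> : L = t * s^-1 by rewrite /t mulrAC divff ?mul1r // gt_eqF.
  ring.
(* The three summands bound [m ln C], [- m ln g] and [mu (ln g - ln C)]. The second uses [m <= g]
   and [m ln (1/m) < 1], the third [ln g < g <= B]. *)
have term i : (m i - mu i) * (lnC i - ln (g i t)) <= B * K + 1 + B * (B + K).
  have /andP[lnC1 lnC2] : - K <= lnC i <= K by rewrite -ler_norml.
  have le1 : m i * lnC i <= B * K.
    apply: le_trans (_ : m i * K <= _); first by rewrite ler_pM2l.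
    by rewrite ler_wpM2r // (le_trans (mg i)).
  have le2 : - (m i * ln (g i t)) <= 1.
    have : ln (m i) <= ln (g i t).
      by rewrite ler_ln // posrE ?gpos // ltW.
    rewrite -(ler_pM2l (mpos i)) => le_ln.
    have : ln (m i)^-1 < (m i)^-1 by apply: ln_sublinear; rewrite invr_gt0.
    rewrite lnV ?posrE // -(ltr_pM2l (mpos i)) divff ?gt_eqF //; lra.
  have le3 : mu i * (ln (g i t) - lnC i) <= B * (B + K).
    apply: le_trans (_ : mu i * (B + K) <= _); last first.
      by rewrite ler_wpM2r // addr_ge0.
    rewrite ler_wpM2l ?mumin.1 // lerD //; last by lra.
    by rewrite ltW // (lt_le_trans _ (gB i)) // ln_sublinear // gpos // ltW.
  lra.
rewrite ler_pdivlMr // mulrC dotMB mulr_sumr.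
have VI : 0 <= t * \sum_i gradF X y k s mu i * (m i - mu i).
  rewrite mulr_ge0 ?(ltW t0) //; apply: minimizer_variational => // i.
  exact: ltW.
apply: (@le_trans _ _ (\sum_(i < d) (m i - mu i) * (lnC i - ln (g i t)))).
  rewrite -subr_ge0; apply: le_trans VI _.
  rewrite mulr_sumr -sumrB; apply: ler_sum => i _.
  rewrite -gradE /gradF le_eqVlt; apply/orP; left; apply/eqP; ring.
rewrite mulr_natl -[d in _ *+ d]card_ord -sumr_const.
by apply: ler_sum => i _; exact: term.
Qed.

(** On the support, slackness reads [s M mu(s) = s r - k]. Subtracting this at [s] and [u] cancels
    [k], and the quotient satisfies the system that characterizes [theta_star]. *)
Lemma minimizer_slope k (mu : R -> 'I_d -> R) (s u : R) :
  (forall s, 0 < s -> is_minimizer X y k s (mu s)) ->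
  0 < s -> s < u -> supp (mu s) = supp (mu u) ->
  forall i, (u - s)^-1 * (u * mu u i - s * mu s i) =
    theta_star X y (supp (mu s)) i.
Proof.
move=> mumin s0 su eqI.
have muout (v : R) i : 0 < v -> i \notin supp (mu v) -> mu v i = 0.
  move=> v0; rewrite inE -leNgt => le0; apply/eqP.
  by rewrite eq_le le0 (mumin v v0).1.
have muin (v : R) i : 0 < v -> i \in supp (mu v) ->
    v * mulM X (mu v) i = v * rvec X y i - k i.
  move=> v0; rewrite inE => mu0.
  have /eqP := minimizer_grad_mul (mumin v v0) i.
  rewrite mulf_eq0 (gt_eqF mu0) orbF /gradF => /eqP g0.
  have -> : k i = v * (v^-1 * k i) by rewrite mulVKf // gt_eqF.
  rewrite -mulrBr; congr (_ * _); lra.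
have u0 : 0 < u := lt_trans s0 su.
apply: (theta_star_unique r_gt0 M_le0) => i iI.
  by rewrite !muout // -?eqI // !mulr0 subrr mulr0.
have -> : mulM X (fun j => (u - s)^-1 * (u * mu u j - s * mu s j)) i =
    (u - s)^-1 * (u * mulM X (mu u) i - s * mulM X (mu s) i).
  rewrite /mulM !mulr_sumr -sumrB mulr_sumr; apply: eq_bigr => j _; ring.
rewrite !muin // -?eqI //.
have -> : u * rvec X y i - k i - (s * rvec X y i - k i) = (u - s) * rvec X y i.
  by ring.
by rewrite mulKf // subr_eq0 gt_eqF.
Qed.

(** Supports grow with [s], so those of equal cardinality coincide. A discontinuity can only be an
    endpoint of one of the [d + 1] level sets [N c] of the cardinality. *)
Lemma finite_discontinuities k (mu : R -> 'I_d -> R) : (forall i, 0 < k i) ->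
  (forall s, 0 < s -> is_minimizer X y k s (mu s)) ->
  finite_set [set s : R | 0 < s /\ Idisc mu s].
Proof.
move=> k0 mumin.
have mono (s u : R) : 0 < s -> s <= u -> supp (mu s) \subset supp (mu u).
  move=> s0 su; apply/fintype.subsetP => i; rewrite !inE => /lt_le_trans; apply.
  exact: (minimizer_monotone r_gt0 M_le0 k0 s0 su (mumin s s0)
    (mumin u (lt_le_trans s0 su))).
pose N (c : 'I_d.+1) := [set s : R | 0 < s /\ #|supp (mu s)| = c :> nat].
(* [F] lists all candidate endpoints: the boolean selects the lower or the upper one. *)
pose F (p : 'I_d.+1 * bool) := if p.2 then inf (N p.1) else sup (N p.1).
apply: (@sub_finite_set _ _ (F @` [set: 'I_d.+1 * bool])); last first.
  exact/finite_image/finite_finset.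
move=> s [s0 disc].
have cP : (#|supp (mu s)| < d.+1)%N by rewrite ltnS -[X in (_ <= X)%N]card_ord max_card.
pose c : 'I_d.+1 := Ordinal cP.
have Ns : N c s by [].
have [[a [Na as_]]|noa] := pselect (exists a, N c a /\ a < s); last first.
  exists (c, true) => //; apply/eqP; rewrite /F /= eq_le.
  have lbs : lbound (N c) s.
    by move=> a Na; rewrite leNgt; apply/negP => as_; apply: noa; exists a.
  apply/andP; split; last by apply: lb_le_inf => //; exists s.
  by apply: ge_inf => //; exists s.
have [[b [Nb sb]]|nob] := pselect (exists b, N c b /\ s < b); last first.
  exists (c, false) => //; apply/eqP; rewrite /F /= eq_le.
  have ubs : ubound (N c) s.
    by move=> b Nb; rewrite leNgt; apply/negP => sb; apply: nob; exists b.
  apply/andP; split; first by apply: ge_sup => //; exists s.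
  by apply: ub_le_sup => //; exists s.
exfalso; apply: disc.
have near_s : \forall u \near s, a < u < b.
  by apply: filterS2 (lt_nbhsr as_) (lt_nbhsl sb) => u -> ->.
apply: filterS near_s => u /andP[au ub].
have a0 : 0 < a := Na.1.
have eq_of (v : R) : a < v -> v < b -> supp (mu a) = supp (mu v).
  move=> av vb; apply/eqP; rewrite eqEcard mono //= ?(ltW av) //.
  rewrite Na.2 -Nb.2 subset_leq_card // mono // ?(ltW vb) //.
  exact: lt_trans av.
by rewrite -!eq_of.
Qed.

End Averages.

(** * Estimates for the solutions of the flow *)

Section Trajectories.
Context {R : realType} {n d : nat} (X : 'M[R]_(n, d)) (y : 'cV[R]_n).
Context (C k : 'I_d -> R) (theta : R -> R -> 'I_d -> R) (mu : R -> 'I_d -> R).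
Hypothesis r_gt0 : forall i, 0 < rvec X y i.
Hypothesis M_le0 : forall i j : 'I_d, i != j -> Mmat X i j <= 0.
Hypothesis C_gt0 : forall i, 0 < C i.
Hypothesis k_gt0 : forall i, 0 < k i.
Hypothesis theta_sol : is_DLN_solution X y C k theta.
Hypothesis mu_min : forall s : R, 0 < s -> is_minimizer X y k s (mu s).

Definition primitive (eps t : R) (i : 'I_d) : R :=
  \int[lebesgue_measure]_(u in `[0, t]) theta eps u i.

(** The last hypothesis on [eps] says that all growth rates are positive at time 0, which starts the
    Lotka-Volterra analysis; the log identity then feeds [average_near_minimizer]. *)
Lemma trajectory_estimates (B K eps : R) :
  0 <= B ->
  (forall v, dotM X v v <= \sum_i rvec X y i * v i -> forall i, v i <= B) ->
  (forall i, `|ln (C i)| <= K) -> 0 <= K -> 0 < eps -> 0 < ln eps^-1 ->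
  (forall i, mulM X (fun j => C j * eps `^ k j) i < rvec X y i) ->
  (forall i (t u : R), 0 <= t -> t <= u ->
    (u - t) * theta eps t i <= primitive eps u i - primitive eps t i
      <= (u - t) * theta eps u i) /\
  (forall s : R, 0 < s ->
    let t := s * ln eps^-1 in
    let v i := t^-1 * primitive eps t i - mu s i in
    dotM X v v <= (d%:R * (B * K + 1 + B * (B + K))) / t).
Proof.
move=> B0 subB CK K0 eps0 L0 init_sub.
have [th0 [thc thd]] := theta_sol eps0.
(* The even extension of the trajectory is continuous on all of [R]. *)
pose g i (t : R) := theta eps `|t| i.
have gE (t : R) : 0 <= t -> g ^~ t = theta eps t.
  by move=> t0; apply/funext => i; rewrite /g ger0_norm.
have g_cont i : continuous (g i).
  exact: (@continuous_comp_norm R (fun t => theta eps t i) (thc i)).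
have g_derive i (t : R) : 0 < t ->
    is_derive t 1 (g i) (g i t * (rvec X y i - mulM X (g ^~ t) i)).
  move=> t0; rewrite gE ?(ltW t0) // /g gtr0_norm //.
  apply: near_eq_is_derive (thd i t t0) => //.
  by apply: filterS (lt_nbhsr t0) => u u0; rewrite gtr0_norm.
have /choice[G GP] i := primitive_exists (g_cont i).
have G0 i : G i 0 = 0 by have [] := GP i.
have G_derive i (t : R) : -1 < t -> is_derive t 1 (G i) (g i t).
  by have [_ + _] := GP i; apply.
have GE i (t : R) : 0 <= t -> G i t = primitive eps t i.
  move=> t0; have [_ _ ->] := GP i => //; apply: eq_Rintegral => u.
  by rewrite inE /= in_itv => /andP[u0 _]; rewrite /g ger0_norm.
have g0E i : g i 0 = C i * eps `^ k i by rewrite /g normr0 th0.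
have g0_gt0 i : 0 < g i 0 by rewrite g0E mulr_gt0 // powR_gt0.
have g0_sub i : mulM X (g ^~ 0) i < rvec X y i.
  by have -> : g ^~ 0 = (fun j => C j * eps `^ k j) by apply/funext.
have gpos := LV_gt0 g_cont g_derive G0 G_derive g0_gt0.
have grate := LV_rate_gt0 M_le0 g_cont g_derive G0 G_derive g0_gt0 g0_sub.
have gG := LV_integral_bounds M_le0 g_cont g_derive G0 G_derive g0_gt0 g0_sub.
split=> [i t u t0 tu|s s0 /=].
  have u0 := le_trans t0 tu.
  by rewrite -!GE // -!gE //; exact: gG.
have t0 : 0 < s * ln eps^-1 by rewrite mulr_gt0.
have -> : (fun i => (s * ln eps^-1)^-1 * primitive eps (s * ln eps^-1) i - mu s i)
    = (fun i => (s * ln eps^-1)^-1 * G i (s * ln eps^-1) - mu s i).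
  by apply/funext => i; rewrite GE // ltW.
apply: (@average_near_minimizer R n d X y k (fun i => ln (C i)) g G) => //.
- by move=> i t t_ge0; apply: ltW; exact: grate.
- move=> i t t_ge0; rewrite (LV_expE g_cont g_derive G0 G_derive i t_ge0).
  rewrite lnM ?posrE ?expR_gt0 // expRK g0E lnM ?posrE ?powR_gt0 // ln_powR.
  by rewrite lnV ?posrE //; ring.
- move=> i t t_gt0; have := gG i 0 t (lexx 0) (ltW t_gt0).
  rewrite G0 !subr0 => /andP[tG ->]; rewrite andbT.
  by apply: lt_le_trans tG; rewrite mulr_gt0 // gpos.
exact: mu_min.
Qed.

(** The squared error [W / (s ln(1/eps))] decreases in [s], so one threshold on [eps] serves all
    [s >= a]. *)
Lemma averages_uniform (a e : R) : 0 < a -> 0 < e ->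
  \forall eps \near 0^'+,
  [/\ 0 < ln eps^-1,
      (forall i (t u : R), 0 <= t -> t <= u ->
        (u - t) * theta eps t i <= primitive eps u i - primitive eps t i
          <= (u - t) * theta eps u i) &
      (forall s i, a <= s ->
        `|(s * ln eps^-1)^-1 * primitive eps (s * ln eps^-1) i - mu s i| < e)].
Proof.
move=> a0 e0.
have [B B0 subB] := subsolution_bounded r_gt0 M_le0.
have [c c0 coer] := dotM_coercive r_gt0 M_le0.
pose K := \sum_i `|ln (C i)|.
have K0 : 0 <= K by apply: sumr_ge0.
have CK i : `|ln (C i)| <= K by rewrite /K (bigD1 i) //= lerDl sumr_ge0.
pose W := d%:R * (B * K + 1 + B * (B + K)).
have W0 : 0 <= W.
  by rewrite mulr_ge0 // !addr_ge0 // mulr_ge0 ?addr_ge0 // ltW.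
(* Chosen so that [a A > W (c/e)^2]: once [ln(1/eps) > A], the bound [W / t] is below [(e/c)^2], and
   coercivity yields an error below [e]. *)
pose A := W * (c / e) ^+ 2 / a + 1.
have A0 : 0 < A.
  by rewrite ltr_wpDl // divr_ge0 ?(ltW a0) //; exact: (mulr_ge0 W0 (sqr_ge0 _)).
(* The initial point tends to 0 because [k > 0], so its image under [M] eventually lies below
   [r > 0]. *)
have small : \forall eps \near (0 : R)^'+, forall i,
    mulM X (fun j => C j * eps `^ k j) i < rvec X y i.
  apply: (@filter_forall R 'I_d (fun i eps =>
    mulM X (fun j => C j * eps `^ k j) i < rvec X y i) ((0 : R)^'+)) => i.
  apply: (cvgr_lt (mulM X (fun j => C j * 0) i)).
    apply: (@cvg_mulM R n d X _ (fun j eps => C j * eps `^ k j)) => j.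
    by apply: cvgMl_tmp; exact: powR_cvg0.
  by rewrite /mulM big1 // => j _; rewrite !mulr0.
near=> eps.
have eps0 : 0 < eps by near: eps; exact: nbhs_right_gt.
have L_gt : A < ln eps^-1.
  rewrite lnV ?posrE // ltrNr -[ltRHS]expRK ltr_ln ?posrE ?expR_gt0 //.
  by near: eps; apply: nbhs_right_lt; exact: expR_gt0.
have L0 : 0 < ln eps^-1 := lt_trans A0 L_gt.
have init_sub i : mulM X (fun j => C j * eps `^ k j) i < rvec X y i.
  by move: i; near: eps.
have [bnds est] := trajectory_estimates (ltW B0) subB CK K0 eps0 L0 init_sub.
split=> // s i as_; have s0 := lt_le_trans a0 as_.
set t := s * ln eps^-1; have t0 : 0 < t by rewrite mulr_gt0.
pose v j := t^-1 * primitive eps t j - mu s j.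
have vW : dotM X v v <= W / t by exact: est.
have Wt : W / t < (e / c) ^+ 2.
  rewrite ltr_pdivrMr //.
  have ec : (e / c) ^+ 2 * (c / e) ^+ 2 = 1.
    rewrite -exprMn; have -> : e / c * (c / e) = 1; last exact: expr1n.
    by field; rewrite !gt_eqF.
  have : W * (c / e) ^+ 2 < t.
    apply: lt_le_trans (_ : a * A <= _).
      by rewrite /A mulrDr mulr1 [a * (_ / a)]mulrC divfK ?gt_eqF // ltrDl.
    by rewrite ler_pM // ltW.
  rewrite -(ltr_pM2l (_ : 0 < (e / c) ^+ 2)) ?exprn_gt0 ?divr_gt0 //.
  by rewrite mulrCA ec mulr1.
apply: le_lt_trans (coer v i) _.
have -> : e = c * Num.sqrt ((e / c) ^+ 2).
  by rewrite sqrtr_sqr ger0_norm ?divr_ge0 ?(ltW e0) ?(ltW c0) // mulrC divfK ?gt_eqF.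
rewrite ltr_pM2l // ltr_sqrt ?exprn_gt0 ?divr_gt0 //.
exact: le_lt_trans Wt.
Unshelve. all: by end_near. Qed.

End Trajectories.

(** * Limits uniform on compact sets *)

Section Limits.
Context {R : realType} {n d : nat} (X : 'M[R]_(n, d)) (y : 'cV[R]_n).
Context (C k : 'I_d -> R) (theta : R -> R -> 'I_d -> R) (mu : R -> 'I_d -> R).
Hypothesis r_gt0 : forall i, 0 < rvec X y i.
Hypothesis M_le0 : forall i j : 'I_d, i != j -> Mmat X i j <= 0.
Hypothesis C_gt0 : forall i, 0 < C i.
Hypothesis k_gt0 : forall i, 0 < k i.
Hypothesis theta_sol : is_DLN_solution X y C k theta.
Hypothesis mu_min : forall s : R, 0 < s -> is_minimizer X y k s (mu s).

(** Compactness in near-covering form reduces the claim to a neighbourhood of each [s]; there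
    [u > s / 2] and [averages_uniform] applies. *)
Lemma averages_cvg_compact (K : set R) i (e : R) :
  compact K -> K `<=` [set s | 0 < s] -> 0 < e ->
  \forall eps \near 0^'+, forall s, K s ->
    `|(s * ln eps^-1)^-1 * primitive theta eps (s * ln eps^-1) i - mu s i| < e.
Proof.
move=> /compact_near_coveringP cK K_gt0 e0.
apply: (cK R ((0 : R)^'+) (fun eps s =>
  `|(s * ln eps^-1)^-1 * primitive theta eps (s * ln eps^-1) i - mu s i| < e)).
move=> s /K_gt0 /= s0.
have s20 : 0 < s / 2 by lra.
have unif :=
  averages_uniform r_gt0 M_le0 C_gt0 k_gt0 theta_sol mu_min s20 e0.
have nears : \forall u \near s, s / 2 < u by apply: lt_nbhsr; lra.
refine (ex_intro2 _ _ ([set u | s / 2 < u], _) (conj nears unif) _).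
by move=> [u eps] [/= su [_ _]]; apply; exact: ltW.
Qed.

(* By monotonicity [theta eps (u L) i] lies between the averages of
   [theta eps _ i] over [(u - h) L, u L] and over [u L, (u + h) L]; when the support of
   the minimizer is constant on [u - h, u + h], both tend to [theta_star]. *)
Lemma trajectory_cvg_near (s : R) i (e : R) :
  0 < s -> ~ Idisc mu s -> 0 < e ->
  \forall u \near s & eps \near 0^'+,
    `|theta eps (u * ln eps^-1) i - theta_star X y (supp (mu u)) i| < e.
Proof.
move=> s0 /contrapT [b /= b0 supp_const] e0.
(* For [u] within [h] of [s], the window from [u - h] to [u + h] stays where the support is constant
   and above [s / 2], where the averages are controlled. *)
pose h : R := Num.min b s / 4.
have h0 : 0 < h by rewrite divr_gt0 // lt_min b0.
have [hb hs] : 4 * h <= b /\ 4 * h <= s.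
  by rewrite /h mulrC divfK // !ge_min !lexx orbT.
clearbody h.
have suppE (u : R) : s - 3 * h < u -> u < s + 3 * h -> supp (mu u) = supp (mu s).
  by move=> su us; apply: supp_const; rewrite /= ltr_norml; apply/andP; split; lra.
(* The errors at both ends of a window total at most [(2 u + h) e'], and [u < s + h] makes this less
   than [e h]. *)
pose e' : R := e * h / (2 * s + 3 * h).
have e'0 : 0 < e' by rewrite divr_gt0 ?mulr_gt0 //; lra.
have e'E : (2 * s + 3 * h) * e' = e * h.
  by rewrite mulrC divfK // gt_eqF //; lra.
have s20 : 0 < s / 2 by lra.
have unif :=
  averages_uniform r_gt0 M_le0 C_gt0 k_gt0 theta_sol mu_min s20 e'0.
have nears : \forall u \near s, s - h < u < s + h.
  have sh1 : s - h < s by lra.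
  have sh2 : s < s + h by lra.
  by apply: filterS2 (lt_nbhsr sh1) (lt_nbhsl sh2) => u -> ->.
refine (ex_intro2 _ _ ([set u | s - h < u < s + h], _) (conj nears unif) _).
move=> [u eps] [/= /andP[su us] [L0 bnds avg]].
set L := ln eps^-1 in L0 avg *.
(* Up to the factor [L], the primitive is [v] times an average, hence close to [v * mu v i], whose
   increments [minimizer_slope] computes. *)
have PE (v : R) : 0 < v -> primitive theta eps (v * L) i =
    L * (v * ((v * L)^-1 * primitive theta eps (v * L) i)).
  by move=> v0; field; rewrite !gt_eqF.
have u0 : 0 < u by lra.
have avg_le (v : R) : s / 2 <= v ->
    - (v * e') <= v * ((v * L)^-1 * primitive theta eps (v * L) i) - v * mu v i
      <= v * e'.
  move=> sv; have v0 : 0 < v by lra.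
  rewrite -ler_norml -mulrBr normrM gtr0_norm // ler_pM2l // ltW //.
  exact: avg.
have slope (v : R) : 0 < v -> s - 3 * h < v -> v + h < s + 3 * h ->
    (v + h) * mu (v + h) i - v * mu v i = h * theta_star X y (supp (mu s)) i.
  move=> v0 sv vs; have vvh : v < v + h by lra.
  rewrite -(suppE v) //; last by lra.
  rewrite -(minimizer_slope r_gt0 M_le0 mu_min v0 vvh); last first.
    by rewrite !suppE //; lra.
  have -> : v + h - v = h by ring.
  by rewrite mulVKf // gt_eqF.
have le_e' : u * e' < (s + h) * e' by rewrite ltr_pM2r.
rewrite suppE; [|lra|lra].
set ts := theta_star _ _ _ _ in slope *; set x := theta _ _ _.
have up : h * x <= h * ts + (2 * u + h) * e'.
  have uL : u * L <= (u + h) * L by rewrite ler_pM2r // lerDl ltW.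
  have /andP[+ _] := bnds i _ _ (ltW (mulr_gt0 u0 L0)) uL.
  rewrite (PE u) // (PE (u + h)) ?addr_gt0 //.
  rewrite -mulrBr -mulrBl addrAC subrr add0r (mulrC h) -mulrA ler_pM2l //.
  have /andP[_ A1] := avg_le (u + h) ltac:(lra).
  have /andP[A2 _] := avg_le u ltac:(lra).
  have := slope u u0 ltac:(lra) ltac:(lra).
  rewrite /x; lra.
have lo : h * ts - (2 * u - h) * e' <= h * x.
  have uh0 : 0 < u - h by lra.
  have uL : (u - h) * L <= u * L by rewrite ler_pM2r // gerBl ltW.
  have /andP[_] := bnds i _ _ (ltW (mulr_gt0 uh0 L0)) uL.
  rewrite (PE u) // (PE (u - h)) //.
  rewrite -mulrBr -mulrBl subKr (mulrC h) -mulrA ler_pM2l //.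
  have /andP[_ A1] := avg_le (u - h) ltac:(lra).
  have /andP[A2 _] := avg_le u ltac:(lra).
  have := slope (u - h) uh0 ltac:(lra) ltac:(lra); rewrite subrK.
  rewrite /x; lra.
have he' : 0 < h * e' by rewrite mulr_gt0.
rewrite ltr_norml -(ltr_pM2l h0 (- e)) -(ltr_pM2l h0 (x - ts)).
apply/andP; split; lra.
Qed.

Lemma trajectory_cvg_compact (K : set R) i (e : R) :
  compact K -> K `<=` [set s | 0 < s /\ ~ Idisc mu s] -> 0 < e ->
  \forall eps \near 0^'+, forall s, K s ->
    `|theta eps (s * ln eps^-1) i - theta_star X y (supp (mu s)) i| < e.
Proof.
move=> /compact_near_coveringP cK K_cont e0.
apply: (cK R ((0 : R)^'+) (fun eps s =>
  `|theta eps (s * ln eps^-1) i - theta_star X y (supp (mu s)) i| < e)).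
by move=> s /K_cont[s0 sC]; exact: trajectory_cvg_near.
Qed.

End Limits.

Theorem theorem1 (R : realType) (n d : nat) (X : 'M[R]_(n, d)) (y : 'cV[R]_n)
  (C k : 'I_d -> R) (theta : R -> R -> 'I_d -> R) (mu : R -> 'I_d -> R) :
  (* (A1) r > 0 *)
  (forall i, 0 < rvec X y i) ->
  (* (A2) M_ij <= 0 for i <> j *)
  (forall i j : 'I_d, i != j -> Mmat X i j <= 0) ->
  (forall i, 0 < C i) -> (forall i, 0 < k i) ->
  is_DLN_solution X y C k theta ->
  (* mu(s) is a minimizer of the regularized constrained problem *)
  (forall s, 0 < s -> is_minimizer X y k s (mu s)) ->
  [/\
   (* (0) the minimizer is unique *)
   (forall s th, 0 < s -> is_minimizer X y k s th -> th = mu s),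
   (* (1) monotonicity of mu and of I(s) *)
   (forall s1 s2, 0 < s1 -> s1 <= s2 ->
      (forall i, mu s1 i <= mu s2 i) /\ supp (mu s1) \subset supp (mu s2)),
   (* the discontinuity points s_1,...,s_q of s |-> I(s) are finitely many *)
   finite_set [set s : R | 0 < s /\ Idisc mu s],
   (* (2) convergence to theta_*^(I(s)), pointwise and uniformly on compacts *)
   (forall s, 0 < s -> ~ Idisc mu s -> forall i,
      (fun eps => theta eps (s * ln eps^-1) i) @ 0^'+
        --> theta_star X y (supp (mu s)) i) /\
   (forall K : set R, compact K -> K `<=` [set s | 0 < s /\ ~ Idisc mu s] ->
      forall i (e : R), 0 < e -> \forall eps \near 0^'+, forall s, K s ->
        `| theta eps (s * ln eps^-1) i - theta_star X y (supp (mu s)) i | < e)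
   &
   (* (3) convergence of the time averages to mu(s) *)
   (forall s, 0 < s -> forall i,
      (fun eps => (s * ln eps^-1)^-1 *
         \int[lebesgue_measure]_(t in `[0, s * ln eps^-1]) theta eps t i)
        @ 0^'+ --> mu s i) /\
   (forall K : set R, compact K -> K `<=` [set s | 0 < s] ->
      forall i (e : R), 0 < e -> \forall eps \near 0^'+, forall s, K s ->
        `| (s * ln eps^-1)^-1 *
           \int[lebesgue_measure]_(t in `[0, s * ln eps^-1]) theta eps t i
           - mu s i | < e)].

Proof.
move=> r_gt0 M_le0 C_gt0 k_gt0 theta_sol mu_min.
split.
- move=> s th s0 th_min.
  exact: (minimizer_unique r_gt0 M_le0 th_min (mu_min s s0)).
- move=> s1 s2 s10 s12.
  have mono := minimizer_monotone r_gt0 M_le0 k_gt0 s10 s12 (mu_min s1 s10)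
    (mu_min s2 (lt_le_trans s10 s12)).
  split=> //; apply/fintype.subsetP => i; rewrite !inE => mu1.
  exact: lt_le_trans mu1 (mono i).
- exact: (finite_discontinuities r_gt0 M_le0 k_gt0 mu_min).
- have unif := trajectory_cvg_compact r_gt0 M_le0 C_gt0 k_gt0
    theta_sol mu_min.
  split=> [s s0 sC i|K cK K_sub i e e0]; last exact: unif.
  apply/cvgrPdist_lt => e e0.
  (* Pointwise convergence is the uniform statement on a singleton. *)
  have s_sub : [set s] `<=` [set s | 0 < s /\ ~ Idisc mu s] by move=> _ ->.
  have := unif _ i _ (@compact_set1 _ s) s_sub e0.
  by apply: filterS => eps; rewrite distrC; apply.
- have unif := averages_cvg_compact r_gt0 M_le0 C_gt0 k_gt0 theta_sol mu_min.
  split=> [s s0 i|K cK K_sub i e e0]; last exact: unif.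
  apply/cvgrPdist_lt => e e0.
  have s_sub : [set s] `<=` [set s | 0 < s] by move=> _ ->.
  have := unif _ i _ (@compact_set1 _ s) s_sub e0.
  by apply: filterS => eps; rewrite distrC; apply.
Qed.
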